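(* For all integers $q\geq 3$, $f_{2,2}(q,4)=2q-1$.
   Context: Let $q>t\geq s\geq 1$ and $k>1$ be integers. View a $q$-ary code $C$ of length $n$ (a set of words of length $n$ over an alphabet of size $q$) as an array whose rows are the distinct codewords and whose columns are the $n$ coordinates. $C$ is called a $(q,k,n)_{s,t}$-Armstrong code if (i) for any $t+1$ (distinct) rows of $C$, there are at most $k-1$ columns such that each of them has at most $s$ distinct entries in these $t+1$ rows; and (ii) for any $k-1$ columns of $C$, there exist $t+1$ (distinct) rows such that each of the $k-1$ columns has at most $s$ distinct entries in these $t+1$ rows and, further, there exists a column of $C$ having exactly $t+1$ distinct entries in these same $t+1$ rows. $f_{s,t}(q,k)$ denotes the maximum $n$ such that a $(q,k,n)_{s,t}$-Armstrong code exists. *)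

(* Defs.v *)
From mathcomp Require Import all_boot.

Set Implicit Arguments.
Unset Strict Implicit.
Unset Printing Implicit Defensive.

Definition code (q n : nat) : Type := {set {ffun 'I_n -> 'I_q}}.

Definition entries (q n : nat) (R : code q n) (j : 'I_n) : {set 'I_q} :=
  [set w j | w : {ffun 'I_n -> 'I_q} in R].

(* Intended for q > t >= s >= 1 and k > 1, so that k.-1 is the true k - 1. *)
Definition armstrong_code (s t q k n : nat) (C : code q n) : Prop :=
  (forall R : code q n, R \subset C -> #|R| = t.+1 ->
     #|[set j : 'I_n | #|entries R j| <= s]| <= k.-1)
  /\
  (forall K : {set 'I_n}, #|K| = k.-1 ->
     exists R : code q n,
       [/\ R \subset C,
           #|R| = t.+1,
           forall j : 'I_n, j \in K -> #|entries R j| <= s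
         & exists j : 'I_n, #|entries R j| = t.+1]).

Definition armstrong_length (s t q k n : nat) : Prop :=
  exists C : code q n, armstrong_code s t k C.

(* The relation f_{s,t}(q, k) = n; it is kept relational because the maximum
   need not exist for arbitrary parameters. *)
Definition f_eq (s t q k n : nat) : Prop :=
  armstrong_length s t q k n /\
  forall m : nat, armstrong_length s t q k m -> m <= n.

(* Main.v *)
Require Import Defs.
From mathcomp Require Import all_boot all_algebra zify.

(* Upper bound: by (i) the triple of rows that (ii) provides for three columns
   determines these columns, so there are at least as many rows as columns.  If
   there were n >= 2q columns, keep 2q of the rows: in each column at least
   2q(q-1) triples of rows repeat a symbol (the extreme case being a perfect
   matching), while each triple does so in at most 3 columns, whence
   n 2q(q-1) <= 3 C(2q,3), i.e. n <= 2q-1.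

   Construction: rows and columns are indexed by Z/(2q-1), and the entry of row
   a in column h is the circular distance from a to h.  Rows a <> b agree in
   column h exactly when a + b = 2h; since 2 is invertible, three rows have at
   most three such columns, and given columns u, v, w the rows u+v-w, u+w-v,
   v+w-u agree pairwise there. *)

Set Implicit Arguments.
Unset Strict Implicit.
Unset Printing Implicit Defensive.

Import GRing.Theory.

(** * Three-element sets, and columns where a triple of rows repeats a symbol *)

Lemma card3_uniqP (T : finType) (A : {set T}) :
  #|A| = 3 -> exists a b c, uniq [:: a; b; c] /\ A = [set a; b; c].
Proof.
rewrite cardE => A3; have := enum_uniq A; have := mem_enum A.
case: (enum A) A3 => [|a [|b [|c [|? ?]]]] //= _ memA Ua.
exists a, b, c; split=> //; apply/setP=> x.
by rewrite -memA !inE orbA.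
Qed.

Lemma card_set3 (T : finType) (a b c : T) :
  #|[set a; b; c]| = (a \notin [:: b; c]) + (b != c) + 1.
Proof.
rewrite -setUA cardsU1 cards2 !inE.
by case: (b != c); case: (_ || _).
Qed.

Lemma card_set3_uniq (T : finType) (a b c : T) :
  uniq [:: a; b; c] -> #|[set a; b; c]| = 3.
Proof. by rewrite card_set3 /= mem_seq1 andbT => /andP[-> ->]. Qed.

Lemma card_set3_leq2 (T : finType) (a b c : T) :
  (#|[set a; b; c]| <= 2) = ~~ uniq [:: a; b; c].
Proof.
rewrite card_set3 /= mem_seq1 andbT.
by case: (a \notin _); case: (b == c).
Qed.

Lemma entries_set3 q n (a b c : {ffun 'I_n -> 'I_q}) j :
  entries [set a; b; c] j = [set a j; b j; c j].
Proof. by rewrite /entries !imsetU !imset_set1. Qed.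

Lemma sum_bool_card (T : finType) (P : pred T) :
  \sum_z (P z : nat) = #|[set z | P z]|.
Proof.
by rewrite -sum1dep_card [RHS]big_mkcond; apply: eq_bigr => z _; case: (P z).
Qed.

Lemma armstrong_nonrainbow_card q n (C : code q n)
    (a b c : {ffun 'I_n -> 'I_q}) :
  armstrong_code 2 2 4 C -> [set a; b; c] \subset C -> uniq [:: a; b; c] ->
  \sum_j ~~ uniq [:: a j; b j; c j] <= 3.
Proof.
move=> [C3 _] abcC Uabc; have := C3 _ abcC (card_set3_uniq Uabc).
apply: leq_trans; rewrite sum_bool_card subset_leq_card //.
by apply/subsetP=> j; rewrite !inE entries_set3 card_set3_leq2.
Qed.

(** * At least as many rows as columns *)

Lemma bin3_leqW n N : 2 < n -> 'C(n, 3) <= 'C(N, 3) -> n <= N.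
Proof.
case: n => // n n2 le_nN; rewrite leqNgt; apply: contraL le_nN => ltNn.
rewrite -ltnNge binS; apply: (leq_ltn_trans (leq_bin2l 3 (ltnSE ltNn))).
by rewrite -[X in X < _]addn0 ltn_add2l bin_gt0.
Qed.

(** (ii) puts each three-column set [K] inside some [bad R], and (i) forces equality. So the image
    under [bad] of the triples of rows contains all triples of columns. *)
Lemma armstrong_card_geq q n (C : code q n) :
  2 < n -> armstrong_code 2 2 4 C -> n <= #|C|.
Proof.
move=> n2 [C3 CK]; apply: bin3_leqW => //.
rewrite -[n in 'C(n, _)]card_ord -card_draws -cards_draws.
pose bad (R : code q n) := [set j | #|entries R j| <= 2].
apply: leq_trans (leq_imset_card bad _); apply/subset_leq_card/subsetP=> K.
rewrite inE => /eqP K3; have [R [RC R3 RK _]] := CK K K3.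
apply/imsetP; exists R; first by rewrite !inE RC R3 eqxx.
apply/eqP; rewrite eqEcard K3 C3 // andbT; apply/subsetP=> j Kj.
by rewrite inE RK.
Qed.

(** * Counting ordered triples on which a map repeats a value *)

Definition fibre (T I : finType) (f : T -> I) i := #|[set x | f x == i]|.

Lemma sum_fibre (T I : finType) (f : T -> I) : \sum_i fibre f i = #|T|.
Proof.
rewrite -sum1_card (partition_big f xpredT) //=.
by apply: eq_bigr => i _; rewrite sum1dep_card.
Qed.

Lemma sum_other (T I : finType) (f : T -> I) x :
  \sum_y (f x != f y : nat) = #|T| - fibre f (f x).
Proof.
rewrite sum_bool_card cardsCs; congr (_ - _).
by apply: eq_card => y; rewrite !inE negbK eq_sym.
Qed.

Lemma sum_fibreD1 (T I : finType) (f : T -> I) x :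
  \sum_z ((f z == f x) && (z != x) : nat) = fibre f (f x) - 1.
Proof.
rewrite sum_bool_card /fibre (cardsD1 x [set y | f y == f x]) inE eqxx addKn.
by apply: eq_card => z; rewrite !inE andbC.
Qed.

Lemma fibre_gt0 (T I : finType) (f : T -> I) x : 0 < fibre f (f x).
Proof. by rewrite card_gt0; apply/set0Pn; exists x; rewrite inE. Qed.

Lemma fibre_le (T I : finType) (f : T -> I) i : fibre f i <= #|T|.
Proof. exact: max_card. Qed.

Lemma sum_distinct2 (T : finType) (x y : T) : x != y ->
  \sum_z ((z != x) && (z != y) : nat) = #|T| - 2.
Proof.
move=> nxy; rewrite sum_bool_card cardsCs.
suff ->: ~: [set z | (z != x) && (z != y)] = [set x; y] by rewrite cards2 nxy.
by apply/setP=> z; rewrite !inE negb_and !negbK.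
Qed.

(** Three exclusive cases: [x] and [y] share their value, or they do not and [z] joins [x], or [z]
    joins [y]. In the last two the inequalities left out follow from the values of [f]. In each
    product only the second factor involves [z], so the sum over [z] can be taken first. *)
Lemma nonrainbow_split (T I : finType) (f : T -> I) x y z :
  (uniq [:: x; y; z] && ~~ uniq [:: f x; f y; f z] : nat) =
  ((f y == f x) && (y != x)) * ((z != x) && (z != y))
  + (f x != f y) * ((f z == f x) && (z != x))
  + (f x != f y) * ((f z == f y) && (z != y)).
Proof.
rewrite /= !inE /= !andbT [f y == f x]eq_sym [f z == f x]eq_sym
  [f z == f y]eq_sym [y == x]eq_sym [z == x]eq_sym [z == y]eq_sym.
have [exy|] := eqVneq (f x) (f y).
  rewrite /= mul0n !addn0 mulnb.
  by case: (x == y); case: (x == z); case: (y == z).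
case: (eqVneq x y) => [->|nxy nfxy]; first by rewrite eqxx.
case: (eqVneq x z) => [<-|nxz]; rewrite ?eqxx /=.
  by rewrite [f y == _]eq_sym (negPf nfxy).
case: (eqVneq y z) => [<-|nyz]; rewrite ?eqxx /=.
  by rewrite (negPf nfxy).
case: (eqVneq (f x) (f z)) => [<-|_] /=.
  by rewrite [f y == _]eq_sym (negPf nfxy).
by case: (_ == _).
Qed.

(** Let [x] lie in a fibre of size [m], and let [N] be the size of [T]. The first two cases of the
    split give [(m - 1)(N - 2)] and [(N - m)(m - 1)]; exchanging [x] and [y] turns the third into
    the second. The total per [x] is [(m - 1)(3N - 2 - 2m)]. *)
Lemma sum_nonrainbow (T I : finType) (f : T -> I) :
  \sum_x \sum_y \sum_z (uniq [:: x; y; z] && ~~ uniq [:: f x; f y; f z] : nat)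
  = \sum_i fibre f i * ((fibre f i - 1) * (3 * #|T| - 2 - 2 * fibre f i)).
Proof.
pose m x := fibre f (f x).
transitivity (\sum_x (m x - 1) * (3 * #|T| - 2 - 2 * m x)); last first.
  rewrite (partition_big f xpredT) //=; apply: eq_bigr => i _.
  rewrite /fibre -sum1dep_card big_distrl /=.
  by apply: eq_bigr => x /eqP fx; rewrite mul1n /m fx /fibre -sum1dep_card.
have sumz x y : \sum_z (uniq [:: x; y; z] && ~~ uniq [:: f x; f y; f z] : nat)
   = ((f y == f x) && (y != x)) * (#|T| - 2) + (f x != f y) * (m x - 1)
     + (f x != f y) * (m y - 1).
  under eq_bigr => z _ do rewrite nonrainbow_split.
  rewrite !big_split /= -!big_distrr /= !sum_fibreD1; congr (_ + _ + _).
  by case: (eqVneq y x) => [->|nyx]; rewrite ?andbF // sum_distinct2 // eq_sym.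
under eq_bigr => x _ do under eq_bigr => y _ do rewrite sumz.
under eq_bigr => x _ do
  rewrite !big_split /= -!big_distrl /= sum_fibreD1 sum_other.
rewrite big_split /= [X in _ + X]exchange_big /= -big_split /=.
apply: eq_bigr => x _; rewrite -big_distrl /=.
under [\sum_y (_ != _)]eq_bigr => y _ do rewrite eq_sym.
rewrite sum_other -/(m x); have := fibre_gt0 f x; have := fibre_le f (f x).
rewrite -/(m x); move: (m x) => k kT _.
rewrite ![(#|T| - k) * _]mulnC -!mulnDr.
(* For [k <= 1] the factor [k - 1] vanishes; for [k >= 2] also [#|T| >= 2], so no subtraction is
   truncated. *)
case: k kT => [|[|k]] kT; rewrite ?sub0n ?subnn ?mul0n //.
by congr (_ * _); move: kT; move: #|T| => t; lia.
Qed.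

(** A fibre of size [k] contributes at least [12(q - 1)(k - 1)], a linear bound attained at [k = 1]
    and [k = 2]. The [q] sizes add up to [2q], so the numbers [k - 1] add up to [q]. *)
Lemma nonrainbow_lb (T : finType) q (f : T -> 'I_q) :
  3 <= q -> #|T| = 2 * q ->
  12 * q * (q - 1) <=
  \sum_x \sum_y \sum_z (uniq [:: x; y; z] && ~~ uniq [:: f x; f y; f z] : nat).
Proof.
move=> q3 T2q; rewrite sum_nonrainbow T2q.
(* The constant term of the linear bound is moved across, so that an empty fibre causes no negative
   number. *)
suff: \sum_i 12 * (q - 1) * fibre f i <=
      \sum_i (fibre f i * ((fibre f i - 1) * (3 * (2 * q) - 2 - 2 * fibre f i))
              + 12 * (q - 1)).
  rewrite -big_distrr /= sum_fibre big_split /= sum_nat_const card_ord T2q.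
  move: (\sum_i _) (q - 1) => S p; nia.
apply: leq_sum => i _; have := fibre_le f i; rewrite T2q.
move: (fibre f i) => k.
case: k => [|[|k]] lek; [by rewrite muln0|by rewrite subnn mul0n muln1|].
rewrite subSS subn0.
have -> : 3 * (2 * q) - 2 - 2 * k.+2 = 6 * (q - 1) - 2 * k by lia.
suff : 12 * (q - 1) <= k.+2 * (6 * (q - 1) - 2 * k).
  move: (12 * (q - 1)) (_ - 2 * k) => Y X.
  rewrite -(leq_pmul2l (ltn0Sn k)); nia.
(* The slacks [d] and [e] remove all subtraction. The product is concave in [k]: at [k = 0] there is
   equality, and at [e = 0] it equals [4(d + 2)(d + 3) >= 12(d + 2)], which is where [q >= 3]
   enters. *)
have [d qd] : exists d, q = d + 3 by exists (q - 3); lia.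
have [e ke] : exists e, k + e = 2 * d + 4 by exists (2 * d + 4 - k); lia.
have -> : 6 * (q - 1) - 2 * k = 2 * (d + e) + 4 by lia.
by rewrite qd; nia.
Qed.

Lemma sum_uniq3 (T : finType) :
  \sum_(x : T) \sum_(y : T) \sum_(z : T) (uniq [:: x; y; z] : nat) =
  #|T| * (#|T| - 1) * (#|T| - 2).
Proof.
rewrite -mulnA -sum_nat_const; apply: eq_bigr => x _.
transitivity (\sum_y (y != x) * (#|T| - 2)).
  apply: eq_bigr => y _; case: (eqVneq y x) => [->|nyx].
    by rewrite big1 //= => z _; rewrite mem_head.
  rewrite mul1n -(sum_distinct2 nyx); apply: eq_bigr => z _.
  by rewrite /= !inE andbT eq_sym (negPf nyx) /= andbC ![_ == z]eq_sym andbC.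
rewrite -big_distrl /= sum_bool_card; congr (_ * _).
by rewrite subn1 -(cardsC1 x); apply: eq_card => y; rewrite !inE.
Qed.

(** * Upper bound by double counting *)

Lemma armstrong_length_leq q n :
  3 <= q -> armstrong_length 2 2 q 4 n -> n <= 2 * q - 1.
Proof.
move=> q3 [C Ca]; rewrite leqNgt; apply/negP => nlarge.
have /card_geqP[s [Us s2q sC]] : 2 * q <= #|C|.
  by apply: leq_trans (armstrong_card_geq _ Ca); lia.
pose r := tnth (Tuple (introT eqP s2q)).
have inj_r : injective r by exact/tuple_uniqP.
have rC i : r i \in C by apply: sC; exact: mem_tnth.
have lb j := nonrainbow_lb (fun i => r i j) q3 (card_ord _).
have ub : \sum_x \sum_y \sum_z \sum_j
    (uniq [:: x; y; z] && ~~ uniq [:: r x j; r y j; r z j] : nat)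
  <= 3 * (2 * q * (2 * q - 1) * (2 * q - 2)).
  rewrite -[in leqRHS](card_ord (2 * q)) -sum_uniq3 !big_distrr.
  apply: leq_sum => x _; rewrite big_distrr; apply: leq_sum => y _.
  rewrite big_distrr; apply: leq_sum => z _.
  have [Uxyz|_] := boolP (uniq [:: x; y; z]); last by rewrite big1.
  apply: armstrong_nonrainbow_card Ca _ _.
    by apply/subsetP=> w; rewrite !inE => /orP[/orP[]|] /eqP->.
  by rewrite -(map_inj_uniq inj_r) in Uxyz.
(* The right side equals [12q(q - 1)(2q - 1)], so cancelling yields [n <= 2q - 1], against
   [nlarge]. *)
suff: n * (12 * q * (q - 1)) <= 3 * (2 * q * (2 * q - 1) * (2 * q - 2)).
  have -> : 2 * q - 2 = 2 * (q - 1) by lia.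
  have : 0 < 12 * q * (q - 1) by nia.
  move: (q - 1) => p; nia.
apply: leq_trans ub; rewrite -{1}(card_ord n) -sum_nat_const.
have := leq_sum (index_enum 'I_n) (P := xpredT) (fun j _ => lb j).
move=> /leq_trans-> //.
rewrite exchange_big; apply: leq_sum => x _.
rewrite exchange_big; apply: leq_sum => y _.
by rewrite exchange_big.
Qed.

(** * Construction from circular distances *)

Definition circ_norm p (x : 'I_(2 * p).+1) : 'I_p.+1 := inord (minn x (- x)%R).

Lemma oppZp_nat p (x : 'I_(2 * p).+1) :
  (- x)%R = (if x == 0 :> nat then 0 else (2 * p).+1 - x) :> nat.
Proof.
have -> : (- x)%R = ((2 * p).+1 - x) %% (2 * p).+1 :> nat by [].
have := ltn_ord x; case: eqVneq => [->|x0 xlt]; first by rewrite subn0 modnn.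
by rewrite modn_small //; lia.
Qed.

Lemma circ_norm_nat p (x : 'I_(2 * p).+1) :
  circ_norm x = minn x (- x)%R :> nat.
Proof.
(* The smaller of [x] and [2p + 1 - x] is at most [p], so [inord] does not return its default. *)
rewrite inordK // oppZp_nat; have := ltn_ord x.
by case: eqVneq => [->|]; lia.
Qed.

Lemma circ_norm_eq p (x y : 'I_(2 * p).+1) :
  (circ_norm x == circ_norm y) = (x == y) || (x == - y)%R.
Proof.
rewrite -!(inj_eq (@ord_inj _)) !circ_norm_nat !oppZp_nat.
have := ltn_ord x; have := ltn_ord y.
by case: (eqVneq (nat_of_ord x) 0); case: (eqVneq (nat_of_ord y) 0); lia.
Qed.

(** Multiplication by [p + 1] undoes doubling, because [2(p + 1)] is 1 modulo [2p + 1]. *)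
Lemma double_inj p : injective (fun x : 'I_(2 * p).+1 => x + x)%R.
Proof.
move=> x y /= /(congr1 (fun z => z *+ p.+1)%R).
have half (z : 'I_(2 * p).+1) : ((z + z) *+ p.+1 = z)%R.
  rewrite -mulr2n -mulrnA Zp_mulrn; apply: val_inj => /=.
  have -> : z * (2 * p.+1) = z + z * (2 * p).+1 by lia.
  by rewrite addnC modnMDl modn_small.
by rewrite !half.
Qed.

(** Up to renaming, this gives the three pairwise sums of the rows [u + v - w], [u + w - v],
    [v + w - u]: they are the doubles of [u], [v], [w]. *)
Lemma addr_reflect (V : zmodType) (u v w : V) :
  ((u + v - w) + (u + w - v) = u + u)%R.
Proof. by rewrite addrACA [X in (X + _)%R]addrACA -opprD [(w + v)%R]addrC addrK. Qed.

Definition circ_row p (a : 'I_(2 * p).+1) : {ffun 'I_(2 * p).+1 -> 'I_p.+1} :=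
  [ffun h => circ_norm (a - h)%R].

(** Equal norms mean that [a - h] and [b - h] are equal or opposite; the second option rearranges to
    [h + h = a + b]. *)
Lemma circ_row_eq p (a b h : 'I_(2 * p).+1) :
  (circ_row a h == circ_row b h) = (a == b) || (h + h == a + b)%R.
Proof.
rewrite !ffunE circ_norm_eq (inj_eq (addIr _)); congr (_ || _).
by rewrite opprB subr_eq addrAC eq_sym subr_eq.
Qed.

Lemma circ_row_inj p : injective (@circ_row p).
Proof.
(* Column [a] suffices: agreement there means [a = b] or [a + a = a + b]. *)
move=> a b eab; have := circ_row_eq a b a.
by rewrite eab eqxx => /esym; rewrite (inj_eq (addrI _)) orbb => /eqP.
Qed.

Lemma armstrong_length_circ p :
  2 <= p -> armstrong_length 2 2 p.+1 4 (2 * p).+1.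
Proof.
move=> p2; pose C := @circ_row p @: [set: 'I_(2 * p).+1].
have nonrb (a b c : 'I_(2 * p).+1) : uniq [:: a; b; c] ->
  [set j | #|entries [set circ_row a; circ_row b; circ_row c] j| <= 2] =
  [set j | j + j \in [set a + b; a + c; b + c]]%R.
  rewrite /= !inE negb_or andbT => /andP[/andP[nab nac] nbc].
  apply/setP=> j; rewrite !inE entries_set3 card_set3_leq2 /= !inE !circ_row_eq.
  rewrite (negPf nab) (negPf nac) (negPf nbc) /= andbT negb_and !negbK -!orbA.
  by [].
have nonrb3 (R : code p.+1 (2 * p).+1) : R \subset C -> #|R| = 3 ->
     #|[set j | #|entries R j| <= 2]| <= 3.
  move=> RC /card3_uniqP[w1 [w2 [w3 [U eR]]]]; move: RC U.
  rewrite eR => /subsetP RC.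
  have /imsetP[a _ ea] : w1 \in C by apply: RC; rewrite !inE eqxx.
  have /imsetP[b _ eb] : w2 \in C by apply: RC; rewrite !inE eqxx orbT.
  have /imsetP[c _ ec] : w3 \in C by apply: RC; rewrite !inE eqxx orbT.
  rewrite ea eb ec -[X in uniq X]/(map (@circ_row p) [:: a; b; c]).
  rewrite (map_inj_uniq (@circ_row_inj p)) => /nonrb ->.
  (* Doubling is injective, so these columns are no more numerous than the three pairwise sums. *)
  rewrite -(card_imset _ (@double_inj p)).
  apply: (@leq_trans #|[set a + b; a + c; b + c]%R|).
    by apply/subset_leq_card/subsetP=> _ /imsetP[j jS ->]; rewrite inE in jS.
  by rewrite card_set3; case: (_ \notin _); case: (_ == _).
exists C; split=> [R|K K3]; first exact: nonrb3.
have [u [v [w [Uuvw eK]]]] := card3_uniqP K3.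
pose a := (u + v - w)%R; pose b := (u + w - v)%R; pose c := (v + w - u)%R.
have eab : (a + b = u + u)%R by exact: addr_reflect.
have eac : (a + c = v + v)%R by rewrite /a [(u + v)%R]addrC addr_reflect.
have ebc : (b + c = w + w)%R.
  by rewrite /b /c [(u + w)%R]addrC [(v + w)%R]addrC addr_reflect.
(* If two of the rows coincided, their sums with the third would too, hence so would two of the
   doubles of [u], [v], [w]. *)
have Uabc : uniq [:: a; b; c].
  apply: contraTT Uuvw; rewrite /= !inE !negb_and !negbK !orbF.
  case/orP=> [/orP[]|] /eqP e; apply/orP.
  - by right; apply/eqP/double_inj; rewrite /= -eac -ebc e.
  - by left; apply/orP; right; apply/eqP/double_inj; rewrite /= -eab -ebc e addrC.
  - by left; apply/orP; left; apply/eqP/double_inj; rewrite /= -eab -eac e.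
have RC : [set circ_row a; circ_row b; circ_row c] \subset C.
  by apply/subsetP=> _ /[!inE] /orP[/orP[]|] /eqP->; exact: imset_f.
have R3 : #|[set circ_row a; circ_row b; circ_row c]| = 3.
  by apply: card_set3_uniq; rewrite -(map_inj_uniq (@circ_row_inj p)) in Uabc.
exists [set circ_row a; circ_row b; circ_row c]; split=> // [j Kj|].
  have : j \in [set j | j + j \in [set a + b; a + c; b + c]]%R.
    move: Kj; rewrite eK !inE eab eac ebc => /orP[/orP[]|] /eqP->.
    - by rewrite eqxx.
    - by rewrite eqxx orbT.
    - by rewrite eqxx orbT.
  by rewrite -(nonrb _ _ _ Uabc) inE.
(* At most 3 of the [2p + 1 >= 5] columns repeat a symbol, so some column shows three distinct
   entries. *)
have /set0Pn[j] :
   ~: [set j | #|entries [set circ_row a; circ_row b; circ_row c] j| <= 2] != set0.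
  rewrite -card_gt0 cardsCs setCK card_ord; have := nonrb3 _ RC R3.
  move: #|_| => k; lia.
rewrite !inE -ltnNge => j3; exists j; apply/eqP; rewrite eqn_leq j3 andbT.
by rewrite -R3 leq_imset_card.
Qed.

Theorem theorem4 : forall q : nat, 3 <= q -> f_eq 2 2 q 4 (2 * q - 1).
Proof.
move=> q q3; split; last by move=> n; exact: armstrong_length_leq.
case: q q3 => // p p2; have -> : 2 * p.+1 - 1 = (2 * p).+1 by lia.
exact: armstrong_length_circ.
Qed.
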